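(* Let $d=1$, $f(x)=e^{-x}$ and $h(m)=2+\int_{\mathbb{R}}\sin x\,dm(x)$, and let $G:\mathbb{R}\times\mathscr{P}_2(\mathbb{R})\to\mathbb{R}$ be given by $G(x,m)=f(x)h(m)$. Then $G$ satisfies $(\mathrm{L}^2)$, but it satisfies neither the displacement monotonicity condition (D) nor the Lasry–Lions condition (LL).
   Context: $\mathscr{P}_2(\mathbb{R})$: Borel probability measures on $\mathbb{R}$ with finite second moment. $(\Omega,\mathcal{A},\mathbb{P})$ is an atomless probability space, $\mathbb{H}=L^2(\Omega;\mathbb{R})$, $\mathcal{L}_X$ the law of $X\in\mathbb{H}$. (LL): $\int_{\mathbb{R}}(G(x,m_1)-G(x,m_2))\,d(m_1-m_2)(x)\ge0$ for all $m_1,m_2\in\mathscr{P}_2(\mathbb{R})$. (D): $\mathbb{E}[(D_xG(X_1,\mathcal{L}_{X_1})-D_xG(X_2,\mathcal{L}_{X_2}))(X_1-X_2)]\ge0$ for all $X_1,X_2\in\mathbb{H}$. Failure of (LL) or (D) means that there are measures, respectively random variables, for which the expression is well defined and strictly negative. The Lagrangian is $L(x,v)=\frac12|v|^2$. For $X_0\in\mathbb{H}$ and $T>0$ put $\tilde E_T(X)=(I+T\,D_xG(\cdot,\mathcal{L}_X))^{-1}(X_0)$, i.e. $\tilde E_T(X)=Y$ is determined by $Y+T\,D_xG(Y,\mathcal{L}_X)=X_0$ a.s. (single-valued since $x\mapsto G(x,m)$ is convex). Condition $(\mathrm{L}^2)$: for all $X_0\in\mathbb{H}$ and all $T>0$,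 $\mathbb{E}[(\tilde E_T(X_1)-\tilde E_T(X_2))(X_1-X_2)]\le\mathbb{E}|X_1-X_2|^2$ for all $X_1,X_2\in\mathbb{H}$. *)

(* Defs.v *)
From HB Require Import structures.
From mathcomp Require Import all_boot all_order all_algebra.
From mathcomp Require Import all_classical all_reals all_analysis.
From mathcomp Require Import measurable_realfun.

Set Implicit Arguments.
Unset Strict Implicit.
Unset Printing Implicit Defensive.

Import Order.TTheory GRing.Theory Num.Theory.
Import numFieldNormedType.Exports.

Local Open Scope classical_set_scope.
Local Open Scope ring_scope.

Record P2 (R : realType) := MkP2 {
  P2_prob :> probability R R;
  P2_moment : (\int[P2_prob]_x (x ^+ 2)%:E < +oo)%E }.

Definition atomless (d : measure_display) (T : measurableType d) (R : realType)
    (P : probability T R) : Prop :=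
  forall A : set T, measurable A -> (0 < P A)%E ->
    exists B : set T,
      [/\ measurable B, B `<=` A, (0 < P B)%E & (P B < P A)%E].

Lemma one_le_two (R : realType) : (1 <= 2%:E :> \bar R)%E.
Proof. by rewrite lee_fin ler1n. Qed.

(* Square-integrable functions rather than their classes modulo a.s. equality:
   the laws, expectations and a.s. equations below only depend on the class. *)
Notation L2space P := (LfunType P (one_le_two _)).

Lemma law_moment (d : measure_display) (T : measurableType d) (R : realType)
    (P : probability T R) (X : L2space P) :
  (\int[distribution P X]_x (x ^+ 2)%:E < +oo)%E.
Proof.
rewrite ge0_integral_distribution.
- have /Lfun2_integrable_sqr/integrableP[_] := LfunP X.
  apply: le_lt_trans; rewrite le_eqVlt; apply/orP; left; apply/eqP.
  by apply: eq_integral => w _ /=; rewrite ger0_norm ?sqr_ge0// expr2.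
- by apply/measurable_EFinP; exact: measurable_funX.
- by move=> y; rewrite lee_fin sqr_ge0.
Qed.

Definition law (d : measure_display) (T : measurableType d) (R : realType)
    (P : probability T R) (X : L2space P) : P2 R :=
  @MkP2 R (distribution P X) (law_moment X).

Section Conditions.
Variable R : realType.
Implicit Types (G : R -> P2 R -> R) (m : P2 R).

Definition Dx G (x : R) m : R :=
  derive1 (fun y => G y m) x.

Definition LL_integrand G m1 m2 (x : R) : R := G x m1 - G x m2.

Definition LL_defined G m1 m2 : Prop :=
  (P2_prob m1).-integrable setT (EFin \o LL_integrand G m1 m2) /\
  (P2_prob m2).-integrable setT (EFin \o LL_integrand G m1 m2).

Definition LL_pairing G m1 m2 : \bar R :=
  (\int[m1]_x (LL_integrand G m1 m2 x)%:E
     - \int[m2]_x (LL_integrand G m1 m2 x)%:E)%E.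

Definition LasryLions G : Prop :=
  forall m1 m2, LL_defined G m1 m2 -> (0 <= LL_pairing G m1 m2)%E.

Definition LasryLions_fails G : Prop :=
  exists m1 m2, LL_defined G m1 m2 /\ (LL_pairing G m1 m2 < 0)%E.

Lemma LasryLions_failsP G : LasryLions_fails G <-> ~ LasryLions G.
Proof.
split=> [[m1 [m2 [dm lt0]]] LL|nLL].
  by move: (LL m1 m2 dm); rewrite leNgt lt0.
apply: contrapT => nF; apply: nLL => m1 m2 dm; rewrite leNgt; apply/negP => lt0.
by apply: nF; exists m1, m2.
Qed.

Variables (d : measure_display) (T : measurableType d) (P : probability T R).
Implicit Types (X Y : L2space P).

Definition displacement_integrand G X1 X2 (w : T) : R :=
  (Dx G (X1 w) (law X1) - Dx G (X2 w) (law X2)) * (X1 w - X2 w).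

Definition displacement_defined G X1 X2 : Prop :=
  P.-integrable setT (EFin \o displacement_integrand G X1 X2).

Definition displacement_monotone G : Prop :=
  forall X1 X2, displacement_defined G X1 X2 ->
    (0 <= 'E_P[displacement_integrand G X1 X2])%E.

Definition displacement_monotone_fails G : Prop :=
  exists X1 X2, displacement_defined G X1 X2 /\
    ('E_P[displacement_integrand G X1 X2] < 0)%E.

Lemma displacement_monotone_failsP G :
  displacement_monotone_fails G <-> ~ displacement_monotone G.
Proof.
split=> [[X1 [X2 [dX lt0]]] D|nD].
  by move: (D X1 X2 dX); rewrite leNgt lt0.
apply: contrapT => nF; apply: nD => X1 X2 dX; rewrite leNgt; apply/negP => lt0.
by apply: nF; exists X1, X2.
Qed.

(* Y = (I + t D_xG(., law X))^-1 (X0), as the graph of X |-> Y *)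
Definition resolvent G X0 (t : R) X Y : Prop :=
  \forall w \ae P, Y w + t * Dx G (Y w) (law X) = X0 w.

(* The first conjunct says that the resolvent is a well-defined single-valued
   map on L^2, so that the second one, quantified over its graph, is not
   vacuous. *)
Definition condL2 G : Prop :=
  forall X0 (t : R), 0 < t ->
    (forall X, exists Y, resolvent G X0 t X Y /\
       forall Y', resolvent G X0 t X Y' -> \forall w \ae P, Y' w = Y w) /\
    (forall X1 X2 Y1 Y2,
       resolvent G X0 t X1 Y1 -> resolvent G X0 t X2 Y2 ->
       ('E_P[(fun w => (Y1 w - Y2 w) * (X1 w - X2 w))%R]
          <= 'E_P[(fun w => `|X1 w - X2 w| ^+ 2)%R])%E).

End Conditions.

Definition exp_sin_G (R : realType) (x : R) (m : P2 R) : R :=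
  expR (- x) * (2 + \int[m]_y sin y).

(* Main.v *)
Require Import Defs.
From mathcomp Require Import all_boot all_order all_algebra.
From mathcomp Require Import all_classical all_reals all_analysis.
From mathcomp Require Import ring lra measurable_realfun.

(** Write h(m) = 2 + int sin dm, so that 1 <= h <= 3 and
    D_xG(x, m) = - h(m) e^{-x}.

    Condition (L^2).  The resolvent equation reads, pointwise,
    y - t h(m) e^{-y} = x.  Its left-hand side is increasing in y and expands
    distances, so it has one solution, which is a nonexpansive function of x;
    composing it with X0 therefore gives a square-integrable variable.  Only
    the ratio of two values of h moves the solution: if y1 >= y2 solve the
    equation for h1 and h2 at the same x, then h1 e^{-y1} >= h2 e^{-y2}, so
    1 + (y1 - y2) <= e^{y1 - y2} <= h1 / h2, and h2 >= 1 yields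
    y1 - y2 <= h1 - h2 ([resolvent_map_sensitivity]).  As sin is 1-Lipschitz,
    |h(law X1) - h(law X2)| <= E|X1 - X2| ([sin_factor_lipschitz]), whence
    E[(Y1 - Y2)(X1 - X2)] <= (E|X1 - X2|)^2 <= E|X1 - X2|^2.

    Failure of (D).  The derivative in x, of size e^{-x}, is felt most on the
    far left, while the measure only enters through one number h.  Take an
    event A of probability p in (0, 1), which exists since P is atomless, and
    q = 1 - p.  Put both variables near -N on A, X1 being slightly to the right
    of X2, and move the remaining mass from 0 (where sin vanishes) to pi/2
    (where it is 1).  This raises h by about q, so on A the gradients are
    ordered the wrong way, with a loss of order e^N, whereas the gain off A
    stays bounded; N large makes the expectation negative
    ([displacement_fails_exp_sin_G]).

    Failure of (LL).  The pairing factors as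
    (h(m1) - h(m2)) (int e^{-x} dm1 - int e^{-x} dm2), and Dirac masses at pi/2
    and 0 give the two factors opposite signs
    ([LasryLions_fails_exp_sin_G]). *)

Set Implicit Arguments.
Unset Strict Implicit.
Unset Printing Implicit Defensive.
Import Order.TTheory GRing.Theory Num.Theory.
Import numFieldNormedType.Exports.
Local Open Scope classical_set_scope.
Local Open Scope ring_scope.

(** * The pointwise resolvent equation *)

Section Scalar.
Variable R : realType.
Implicit Types (x y c h t : R).

Lemma sin_nonexpansive x y : `|sin x - sin y| <= `|x - y|.
Proof.
wlog xy : x y / y <= x.
  move=> H; have [|/ltW xy] := leP y x; first exact: H.
  by rewrite distrC (distrC x); exact: H.
have [|z _ ->] := @MVT_segment R sin cos y x xy (fun z _ => is_derive_sin z).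
  exact/continuous_subspaceT/continuous_sin.
rewrite normrM ler_piMl//; exact: cos_max.
Qed.

(** The resolvent equation for the law m and the step t, at a single point, is
    [resolvent_map (t * h(m)) y = x]. *)
Definition resolvent_map c y : R := y - c * expR (- y).

(** The map is the identity plus a nondecreasing function. *)
Lemma resolvent_map_expanding c x y : 0 <= c -> x <= y ->
  y - x <= resolvent_map c y - resolvent_map c x.
Proof.
move=> c0 xy; rewrite /resolvent_map.
have : c * expR (- y) <= c * expR (- x) by rewrite ler_wpM2l// ler_expR lerN2.
lra.
Qed.

Lemma resolvent_map_noncontracting c x y : 0 <= c ->
  `|x - y| <= `|resolvent_map c x - resolvent_map c y|.
Proof.
move=> c0; wlog xy : x y / y <= x.
  move=> H; have [|/ltW xy] := leP y x; first exact: H.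
  by rewrite distrC (distrC (resolvent_map c x)); exact: H.
rewrite ger0_norm ?subr_ge0//.
exact: le_trans (resolvent_map_expanding c0 xy) (ler_norm _).
Qed.

Lemma resolvent_map_inj c : 0 <= c -> injective (resolvent_map c).
Proof.
move=> c0 x y e; have := resolvent_map_noncontracting x y c0.
by rewrite e subrr normr0 normr_le0 subr_eq0 => /eqP.
Qed.

Lemma resolvent_map_continuous c : continuous (resolvent_map c).
Proof.
move=> x; apply: cvgB; first exact: cvg_id.
apply: cvgM; first exact: cvg_cst.
apply: (@continuous_comp _ _ _ -%R expR); first exact: opp_continuous.
exact: continuous_expR.
Qed.

(** Expansion from 0 at rate at least 1 forces the map to reach x within the
    distance |x - resolvent_map c 0| of 0. *)
Lemma resolvent_map_surj c x : 0 <= c -> exists y, resolvent_map c y = x.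
Proof.
move=> c0; pose r := `|x - resolvent_map c 0|.
have r0 : 0 <= r by exact: normr_ge0.
have /andP[lo up] : - r <= x - resolvent_map c 0 <= r by rewrite -ler_norml.
have h1 := resolvent_map_expanding c0 r0.
have h2 : - r <= 0 by rewrite oppr_le0.
have {}h2 := resolvent_map_expanding c0 h2.
have rr : - r <= r by lra.
have [||y _ <-] := @IVT R (resolvent_map c) (- r) r x rr; last by exists y.
  exact/continuous_subspaceT/resolvent_map_continuous.
by apply/andP; split; rewrite ?ge_min ?le_max; apply/orP; [left|right]; lra.
Qed.

(** The step t drops out: only the ratio h1 / h2 controls the displacement of
    the solution, and the lower bound 1 on h1, h2 turns the ratio into a
    difference. *)
Lemma resolvent_map_sensitivity t h1 h2 y1 y2 : 0 < t -> 1 <= h1 -> 1 <= h2 ->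
  resolvent_map (t * h1) y1 = resolvent_map (t * h2) y2 ->
  `|y1 - y2| <= `|h1 - h2|.
Proof.
move=> t0; wlog y12 : h1 h2 y1 y2 / y2 <= y1.
  move=> H p1 p2 e; have [|/ltW y12] := leP y2 y1; first by move=> ?; exact: H.
  by rewrite distrC (distrC h1); apply: H.
move=> p1 p2 e; rewrite ger0_norm ?subr_ge0//.
apply: le_trans (ler_norm _).
have e1 : expR (- y2) = expR (- y1) * expR (y1 - y2).
  by rewrite -expRD; congr expR; ring.
have := expR_ge1Dx (y1 - y2); set D := expR (y1 - y2) in e1 *.
have a0 := expR_gt0 (- y1); move: e a0; rewrite /resolvent_map e1.
set a := expR (- y1) => e a0 hD.
(* that is, h1 e^{-y1} >= h2 e^{-y2}, by the equation and y1 >= y2 *)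
have {e} : t * a * (h1 - h2 * D) >= 0.
  have -> : t * a * (h1 - h2 * D) = y1 - y2 by move: e; lra.
  by rewrite subr_ge0.
rewrite pmulr_rge0 ?mulr_gt0// subr_ge0 => hh.
have : h2 * (1 + (y1 - y2)) <= h2 * D by rewrite ler_wpM2l//; lra.
have : (y1 - y2) <= h2 * (y1 - y2) by rewrite ler_peMl// subr_ge0.
lra.
Qed.

End Scalar.

(** * Square-integrable functions on a probability space *)

Section L2.
Context d (T : measurableType d) (R : realType) (P : probability T R).
Implicit Types f g Z : T -> R.

Lemma Lfun2_of_integrable_sqr f : measurable_fun setT f ->
  P.-integrable setT (EFin \o (fun x => f x ^+ 2)) -> f \in Lfun P 2%:E.
Proof.
move=> mf /integrableP[_ fi]; rewrite inE; apply/andP; split; rewrite inE//=.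
rewrite /finite_norm unlock poweR_lty//.
apply: le_lt_trans fi; rewrite le_eqVlt; apply/orP; left; apply/eqP.
apply: eq_integral => x _ /=.
by rewrite powR_mulrn// -normrX.
Qed.

Lemma integrable_bounded f (M : R) : measurable_fun setT f ->
  (forall x, `|f x| <= M) -> P.-integrable setT (EFin \o f).
Proof.
move=> mf fM; apply: (@le_integrable _ _ _ _ _ _ _ (EFin \o cst M)) => //.
- exact/measurable_EFinP.
- move=> x _ /=; rewrite lee_fin (le_trans (fM x))// ler_norm//.
- exact: finite_measure_integrable_cst.
Qed.

Lemma Lfun2_bounded f (M : R) : measurable_fun setT f ->
  (forall x, `|f x| <= M) -> f \in Lfun P 2%:E.
Proof.
move=> mf fM; apply: Lfun2_of_integrable_sqr => //.
apply: (@integrable_bounded _ (M ^+ 2)); first exact: measurable_funX.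
by move=> x; rewrite normrX lerXn2r// nnegrE (le_trans _ (fM x)).
Qed.

Lemma Lfun2_nonexpansive (phi : R -> R) f :
  (forall x y, `|phi x - phi y| <= `|x - y|) ->
  f \in Lfun P 2%:E -> phi \o f \in Lfun P 2%:E.
Proof.
move=> phl fL.
have cphi : continuous phi.
  move=> x; apply/cvgrPdist_le => e e0; near=> y.
  apply: le_trans (phl _ _) _; near: y.
  by move: e e0; apply/cvgrPdist_le; exact: cvg_id.
have mf : measurable_fun setT f by move: fL; rewrite inE => /andP[/[!inE]].
have mpf : measurable_fun setT (phi \o f).
  by apply: measurableT_comp => //; exact: continuous_measurable_fun.
have sL : P.-integrable setT
    (EFin \o (fun x => 2 * (f x ^+ 2) + 2 * phi 0 ^+ 2)).
  rewrite (_ : _ \o _ =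
    (fun x => (2%:E * (f x ^+ 2)%:E + (2 * phi 0 ^+ 2)%:E)%E)); last first.
    by apply/funext => x /=; rewrite EFinD EFinM.
  apply: integrableD => //; last exact: finite_measure_integrable_cst.
  by apply: integrableZl => //; exact: Lfun2_integrable_sqr.
apply: Lfun2_of_integrable_sqr => //.
apply: le_integrable sL => //.
  by apply/measurable_EFinP; exact: measurable_funX.
move=> x _ /=; rewrite lee_fin [leLHS]ger0_norm ?sqr_ge0//.
apply: le_trans (ler_norm _).
have /(lerXn2r 2 (normr_ge0 _) (normr_ge0 _)) := phl (f x) 0.
rewrite subr0 !real_normK ?num_real// => hh.
(* u^2 <= 2 (u - v)^2 + 2 v^2 with u = phi (f x), v = phi 0 *)
have := sqr_ge0 (phi (f x) - 2 * phi 0); nra.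
Unshelve. all: by end_near. Qed.

(** Integrate 2 m |Z| <= |Z|^2 + m^2, with m the mean of |Z|. *)
Lemma sqr_mean_le Z : Z \in Lfun P 2%:E ->
  (\int[P]_w `|Z w|) ^+ 2 <= \int[P]_w (`|Z w| ^+ 2).
Proof.
move=> ZL; have ZL1 : Z \in Lfun P 1 by rewrite Lfun_subset12 ?fin_num_measure.
have iN : P.-integrable setT (EFin \o (fun w => `|Z w|)).
  by apply/Lfun1_integrable; exact: Lfun_norm.
have iS : P.-integrable setT (EFin \o (fun w => `|Z w| ^+ 2)).
  under eq_fun do rewrite real_normK ?num_real//.
  exact: Lfun2_integrable_sqr.
set m := \int[P]_w `|Z w|.
have iM : P.-integrable setT (EFin \o (fun w => 2 * m * `|Z w|)).
  exact: (integrableZl measurableT (2 * m) iN).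
have iC : P.-integrable setT (EFin \o (fun _ => m ^+ 2)).
  exact: finite_measure_integrable_cst.
have: \int[P]_w (2 * m * `|Z w|) <= \int[P]_w (`|Z w| ^+ 2 + m ^+ 2).
  apply: le_Rintegral => //; last first.
    by move=> w _; have := sqr_ge0 (`|Z w| - m); lra.
  exact: (integrableD measurableT iS iC).
have P1 : fine (P setT) = 1 by rewrite probability_setT.
rewrite RintegralD// RintegralZl// Rintegral_cst// P1 -/m; lra.
Qed.

Definition two_valued (A : set T) (a b : R) (w : T) : R :=
  if w \in A then a else b.

Lemma two_valuedE A a b :
  two_valued A a b = fun w => (a - b) * \1_A w + b.
Proof.
apply/funext => w; rewrite /two_valued indicE.
by case: (w \in A); rewrite ?mulr1 ?mulr0 ?subrK ?add0r.
Qed.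

Lemma measurable_two_valued A a b : measurable A ->
  measurable_fun setT (two_valued A a b).
Proof.
move=> mA; rewrite two_valuedE; apply: measurable_funD => //.
by apply: measurable_funM => //; exact: measurable_indic.
Qed.

Lemma two_valued_bounded A a b w : `|two_valued A a b w| <= `|a| + `|b|.
Proof. by rewrite /two_valued; case: ifP => _; rewrite ?lerDl ?lerDr. Qed.

Lemma integrable_two_valued A a b : measurable A ->
  P.-integrable setT (EFin \o two_valued A a b).
Proof.
move=> mA; apply: integrable_bounded; first exact: measurable_two_valued.
exact: two_valued_bounded.
Qed.

Lemma Rintegral_two_valued A a b : measurable A ->
  \int[P]_w two_valued A a b w = a * fine (P A) + b * (1 - fine (P A)).
Proof.
move=> mA; rewrite two_valuedE.
have iA : P.-integrable setT (EFin \o (\1_A : T -> R)).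
  exact: integrable_indic.
have P1 : fine (P setT) = 1 by rewrite probability_setT.
rewrite RintegralD//; first last.
- exact: finite_measure_integrable_cst.
- exact: (integrableZl measurableT (a - b) iA).
rewrite RintegralZl// Rintegral_cst// P1.
rewrite /Rintegral integral_indic// setIT; ring.
Qed.

Lemma atomless_proper_event : atomless P ->
  exists A, measurable A /\ 0 < fine (P A) < 1.
Proof.
move=> /(_ setT measurableT); rewrite probability_setT.
move=> /(_ lte01)[A [mA _ A0 A1]].
exists A; split=> //; rewrite -!lte_fin fineK ?fin_num_measure//.
by rewrite A0 A1.
Qed.

End L2.

(** * Condition (L^2) *)

Section SinFactor.
Variable R : realType.
Implicit Types m : P2 R.

(** The factor through which G depends on the measure; it lies in [1, 3]. *)
Definition sin_factor m : R := 2 + \int[m]_y sin y.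

Lemma integrable_sin d (T : measurableType d) (P : probability T R)
    (f : T -> R) :
  measurable_fun setT f ->
  P.-integrable setT (EFin \o (fun w => sin (f w))).
Proof.
move=> mf; apply: (@integrable_bounded _ _ _ _ _ 1) => [|w]; last first.
  exact: sin_max.
apply: measurableT_comp => //.
by apply: continuous_measurable_fun; exact: continuous_sin.
Qed.

Lemma sin_factor_ge1 m : 1 <= sin_factor m.
Proof.
have P1 : fine (P2_prob m setT) = 1 by rewrite probability_setT.
have : \int[m]_y (-1) <= \int[m]_y sin y.
  apply: le_Rintegral => // [||x _]; last exact: sin_geN1.
  - exact: finite_measure_integrable_cst.
  - by apply: integrable_sin; exact: measurable_id.
rewrite Rintegral_cst// P1 /sin_factor; lra.
Qed.

Lemma sin_factor_le3 m : sin_factor m <= 3.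
Proof.
have P1 : fine (P2_prob m setT) = 1 by rewrite probability_setT.
have : \int[m]_y sin y <= \int[m]_y 1.
  apply: le_Rintegral => [//|||x _]; last exact: sin_le1.
  - by apply: integrable_sin; exact: measurable_id.
  - exact: finite_measure_integrable_cst.
rewrite Rintegral_cst// P1 /sin_factor; lra.
Qed.

Lemma Dx_exp_sin_G x m :
  Dx (@exp_sin_G R) x m = - (sin_factor m * expR (- x)).
Proof.
rewrite /Dx /exp_sin_G derive1E.
have -> : (fun y => expR (- y) * (2 + \int[m]_y sin y)) =
  sin_factor m \*: (expR \o -%R).
  by apply/funext => y /=; rewrite mulrC.
rewrite deriveZ//= -derive1E derive1_comp// !derive1E derive_val.
rewrite deriveN// derive_id mulrN1 -mulrN.
by [].
Qed.

Variables (d : measure_display) (T : measurableType d) (P : probability T R).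

Lemma sin_factor_law (X : L2space P) :
  sin_factor (law X) = 2 + \int[P]_w sin (X w).
Proof.
rewrite /sin_factor /Rintegral /= integral_distribution//.
- apply/measurable_EFinP.
  apply: continuous_measurable_fun; exact: continuous_sin.
- exact: integrable_sin.
Qed.

Lemma L2_subr (X Y : L2space P) : (fun w => X w - Y w) \in Lfun P 2%:E.
Proof. exact: LfunP (X - Y). Qed.

(** X1 and X2 realize both laws on one probability space, and sin is
    1-Lipschitz. *)
Lemma sin_factor_lipschitz (X1 X2 : L2space P) :
  `|sin_factor (law X1) - sin_factor (law X2)| <= \int[P]_w `|X1 w - X2 w|.
Proof.
rewrite !sin_factor_law opprD addrACA subrr add0r.
have i1 := @integrable_sin _ _ P X1 (@measurable_funPT _ _ _ _ X1).
have i2 := @integrable_sin _ _ P X2 (@measurable_funPT _ _ _ _ X2).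
rewrite -RintegralB//.
have iB : P.-integrable setT (EFin \o (fun w => sin (X1 w) - sin (X2 w))).
  exact: (integrableB measurableT i1 i2).
have iD : (fun w => X1 w - X2 w) \in Lfun P 1.
  by rewrite Lfun_subset12 ?fin_num_measure//; exact: L2_subr.
apply: le_trans (le_normr_Rintegral _ iB) _ => //.
apply: le_Rintegral => //.
- by apply/Lfun1_integrable/Lfun_norm/Lfun1_integrable.
- exact/Lfun1_integrable/Lfun_norm.
- by move=> w _; exact: sin_nonexpansive.
Qed.

Lemma resolventE (X0 X Y : L2space P) t :
  resolvent (@exp_sin_G R) X0 t X Y <->
  \forall w \ae P, resolvent_map (t * sin_factor (law X)) (Y w) = X0 w.
Proof.
rewrite /resolvent /resolvent_map.
have E w : Y w + t * Dx (@exp_sin_G R) (Y w) (law X) =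
           Y w - t * sin_factor (law X) * expR (- Y w).
  by rewrite Dx_exp_sin_G mulrN mulrA.
by split; apply: filterS => w; rewrite E.
Qed.

(** The pointwise solution is a nonexpansive function of the datum, because
    [resolvent_map c] does not contract distances. *)
Lemma resolvent_exists (X0 : L2space P) (c : R) : 0 <= c ->
  exists Y : L2space P, forall w, resolvent_map c (Y w) = X0 w.
Proof.
move=> c0; pose phi x := sval (cid (resolvent_map_surj x c0)).
have phiK x : resolvent_map c (phi x) = x by rewrite /phi; case: cid.
have phi_nexp x y : `|phi x - phi y| <= `|x - y|.
  by rewrite -{2}(phiK x) -{2}(phiK y); exact: resolvent_map_noncontracting.
have YL := Lfun2_nonexpansive phi_nexp (LfunP X0).
by exists (Lfun_Sub (one_le_two R) YL) => w; rewrite Lfun_valP phiK.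
Qed.

Lemma condL2_exp_sin_G : condL2 P (@exp_sin_G R).
Proof.
move=> X0 t t0; have c0 (X : L2space P) : 0 <= t * sin_factor (law X).
  by rewrite mulr_ge0 ?ltW// (lt_le_trans ltr01)// sin_factor_ge1.
split=> [X|X1 X2 Y1 Y2 /resolventE r1 /resolventE r2].
  have [Y YE] := resolvent_exists X0 (c0 X).
  exists Y; split=> [|Y' /resolventE].
    by apply/resolventE; apply: aeW.
  by apply: filterS => w; rewrite -YE; exact: resolvent_map_inj.
set h1 := sin_factor (law X1) in r1 *.
set h2 := sin_factor (law X2) in r2 *.
pose Z w := X1 w - X2 w.
have ZL : Z \in Lfun P 2%:E by exact: L2_subr.
have ZL1 : Z \in Lfun P 1 by rewrite Lfun_subset12 ?fin_num_measure.
have mZ : measurable_fun setT Z by move: ZL; rewrite inE => /andP[/[!inE]].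
have iN : P.-integrable setT (EFin \o (fun w => `|Z w|)).
  by apply/Lfun1_integrable; exact: Lfun_norm.
have iS : P.-integrable setT (EFin \o (fun w => `|Z w| ^+ 2)).
  under eq_fun do rewrite real_normK ?num_real//.
  exact: Lfun2_integrable_sqr.
have mYZ : measurable_fun setT (fun w => (Y1 w - Y2 w) * Z w).
  by apply: measurable_funM => //; exact: measurable_funB.
have bound : \forall w \ae P, `|Y1 w - Y2 w| <= `|h1 - h2|.
  apply: filterS2 r1 r2 => w e1 e2.
  by apply: (resolvent_map_sensitivity t0); rewrite ?sin_factor_ge1// e1 e2.
rewrite !unlock.
apply: (@le_trans _ _ (\int[P]_w (`|h1 - h2| * `|Z w|)%:E)%E).
  apply: le_trans; first exact: lee_abs.
  have mE : measurable_fun setT (EFin \o (fun w => (Y1 w - Y2 w) * Z w)).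
    exact/measurable_EFinP.
  apply: le_trans; first exact: (le_abse_integral P measurableT mE).
  apply: ae_ge0_le_integral => //.
  - by apply: measurableT_comp => //; exact/measurable_EFinP.
  - apply/measurable_EFinP; apply: measurable_funM => //.
    exact: measurableT_comp.
  - apply: filterS bound => w b _ /=.
    by rewrite lee_fin normrM ler_wpM2r.
rewrite -[leLHS]fineK; last first.
  exact: integrable_fin_num (integrableZl measurableT _ iN).
rewrite -[leRHS]fineK; last exact: integrable_fin_num iS.
rewrite lee_fin.
apply: le_trans (sqr_mean_le ZL).
rewrite -/(Rintegral P setT (fun w => `|h1 - h2| * `|Z w|)) RintegralZl//.
rewrite expr2 ler_wpM2r ?Rintegral_ge0//.
exact: sin_factor_lipschitz.
Qed.

End SinFactor.

(** * Failure of displacement monotonicity *)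

(** On A the integrand is (h2 e^N - h1 e^{N - al}) al.  Since
    h1 >= h2 + q - al and h2 <= 3, the shift al = q/10 keeps h1 e^{-al} above
    h2 + q/2, so this integrand is at most - e^N q^2 / 20.  Off A it is at most
    h2 pi/2 <= 6.  The total - p e^N q^2 / 20 + 6 q is negative as soon as
    e^N > 120 / (p q), which e^N > N ensures for N = 120 / (p q). *)
Lemma displacement_fails_exp_sin_G (R : realType) d (T : measurableType d)
  (P : probability T R) : atomless P ->
  displacement_monotone_fails P (@exp_sin_G R).
Proof.
move=> /atomless_proper_event[A [mA]]; set p := fine (P A) => /andP[p0 p1].
pose q := 1 - p; pose al := q / 10; pose N := 120 / (p * q).
have q0 : 0 < q by rewrite /q subr_gt0.
have q1 : q < 1 by rewrite /q; lra.
have L a b : two_valued A a b \in Lfun P 2%:E.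
  apply: Lfun2_bounded; first exact: measurable_two_valued.
  exact: two_valued_bounded.
pose X1 : L2space P := Lfun_Sub (one_le_two R) (L (al - N) (pi / 2)).
pose X2 : L2space P := Lfun_Sub (one_le_two R) (L (- N) 0).
have X1E : X1 =1 two_valued A (al - N) (pi / 2) by move=> w; rewrite Lfun_valP.
have X2E : X2 =1 two_valued A (- N) 0 by move=> w; rewrite Lfun_valP.
set h1 := sin_factor (law X1); set h2 := sin_factor (law X2).
have hE (X : L2space P) a b : X =1 two_valued A a b ->
    sin_factor (law X) = 2 + (sin a * p + sin b * q).
  move=> XE; rewrite sin_factor_law -Rintegral_two_valued//; congr (_ + _).
  by apply: eq_Rintegral => w _; rewrite XE /two_valued; case: ifP.
have h1E := hE _ _ _ X1E; have h2E := hE _ _ _ X2E.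
rewrite sin_pihalf mul1r in h1E; rewrite sin0 mul0r addr0 in h2E.
have h2_le3 : h2 <= 3 by exact: sin_factor_le3.
have h1_ge1 : 1 <= h1 by exact: sin_factor_ge1.
have h12 : h2 + q - al <= h1.
  have al0 : 0 <= al by rewrite /al; lra.
  have := sin_nonexpansive (al - N) (- N).
  rewrite opprK subrK (ger0_norm al0) ler_norml => /andP[sl _].
  rewrite /h1 h1E /h2 h2E; nra.
pose a := (h2 * expR N - h1 * expR (N - al)) * al.
pose b := (h2 - h1 * expR (- (pi / 2))) * (pi / 2).
have DE : displacement_integrand (@exp_sin_G R) X1 X2 =1 two_valued A a b.
  move=> w; rewrite /displacement_integrand !Dx_exp_sin_G -/h1 -/h2 X1E X2E.
  rewrite /two_valued /a /b; case: ifP => _.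
    by rewrite opprB !opprK; ring.
  by rewrite oppr0 expR0; ring.
have {}DE := funext DE.
exists X1, X2; rewrite /displacement_defined DE; split.
  exact: integrable_two_valued.
rewrite unlock -[X in (X < _)%E]fineK; last first.
  by apply: integrable_fin_num => //; exact: integrable_two_valued.
rewrite lte_fin -/(Rintegral P setT _) Rintegral_two_valued// -/p -/q.
have hb : b <= 6.
  have := expR_gt0 (- (pi / 2) : R).
  have := @pihalf_lt2 R; have := @pihalf_ge1 R.
  rewrite /b; set e := expR _ => pi1 pi2 e0.
  have : 0 <= h1 * e by rewrite mulr_ge0// ltW//; lra.
  nra.
have ha : a <= - (expR N * (q ^+ 2 / 20)).
  rewrite /a expRD.
  have := expR_ge1Dx (- al); have := expR_gt0 N.
  set M := expR N; set e := expR (- al) => M0 e1.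
  have h1e : h2 + q / 2 <= h1 * e.
    have : h1 * (1 - al) <= h1 * e by rewrite ler_wpM2l//; lra.
    rewrite /al in h12 *; nra.
  have : 0 <= M * al * (h1 * e - h2 - q / 2).
    by rewrite mulr_ge0 ?mulr_ge0// /al; lra.
  rewrite /al; lra.
have NM : N < expR N by have := expR_ge1Dx N; lra.
have pqN : N * (p * q) = 120 by rewrite /N divfK// gt_eqF// mulr_gt0.
have : 0 < (expR N - N) * (p * q * q) by rewrite !mulr_gt0// subr_gt0.
have : a * p <= - (expR N * (q ^+ 2 / 20)) * p by rewrite ler_wpM2r// ltW.
have : b * q <= 6 * q by rewrite ler_wpM2r// ltW.
have : N * (p * q * q) = 120 * q by rewrite mulrA pqN.
lra.
Qed.

(** * Failure of Lasry-Lions monotonicity *)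

Section LL.
Variable R : realType.

Lemma integral_dirac_EFin (a : R) (f : R -> R) : measurable_fun setT f ->
  (\int[\d_a]_x (f x)%:E = (f a)%:E)%E.
Proof.
move=> mf; rewrite integral_dirac//; last exact/measurable_EFinP.
by rewrite diracT mul1e.
Qed.

Lemma dirac_moment (a : R) : (\int[\d_a]_x (x ^+ 2)%:E < +oo)%E.
Proof. by rewrite integral_dirac_EFin ?ltry//; exact: measurable_funX. Qed.

Definition dirac_P2 (a : R) : P2 R := MkP2 (dirac_moment a).

Lemma sin_factor_dirac a : sin_factor (dirac_P2 a) = 2 + sin a.
Proof.
rewrite /sin_factor /Rintegral integral_dirac_EFin//.
apply: continuous_measurable_fun; exact: continuous_sin.
Qed.

Lemma LasryLions_fails_exp_sin_G : LasryLions_fails (@exp_sin_G R).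
Proof.
exists (dirac_P2 (pi / 2)), (dirac_P2 0).
set m1 := dirac_P2 _; set m2 := dirac_P2 _.
have IE : LL_integrand (@exp_sin_G R) m1 m2 = (fun x => expR (- x)).
  apply/funext => x; rewrite /LL_integrand /exp_sin_G -mulrBr.
  rewrite -/(sin_factor m1) -/(sin_factor m2) !sin_factor_dirac.
  by rewrite sin_pihalf sin0; ring.
have mI : measurable_fun setT (fun x : R => expR (- x)).
  by apply: measurableT_comp => //; exact: measurable_expR.
rewrite /LL_defined /LL_pairing IE /= !integral_dirac_EFin//; split.
  by split; apply/integrableP; split; rewrite ?integral_dirac_EFin ?ltry//;
    solve [exact/measurable_EFinP | exact: measurableT_comp].
rewrite -EFinB lte_fin oppr0 expR0 subr_lt0 expR_lt1 oppr_lt0.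
exact: lt_le_trans ltr01 (@pihalf_ge1 R).
Qed.

End LL.

Theorem proposition4p6 (R : realType) (d : measure_display)
  (Omega : measurableType d) (P : probability Omega R) (hP : atomless P) :
  [/\ condL2 P (@exp_sin_G R),
      displacement_monotone_fails P (@exp_sin_G R)
    & LasryLions_fails (@exp_sin_G R)].
Proof.
split.
- exact: condL2_exp_sin_G.
- exact: displacement_fails_exp_sin_G.
- exact: LasryLions_fails_exp_sin_G.
Qed.
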